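(* Let $h$ (a real function) and $Z$ (a planar vector field) be of class $C^{2}$ near $p\in\mathbb{R}^2$, and let $X=h\,Z$ with $$h(p)=0,\qquad \nabla h(p)\neq0,\qquad Z(p)\neq0 .$$ Then $X(p)=0$, the matrix $J:=DX(p)=Z(p)\,\nabla h(p)^{\top}$ has rank one, and $\ker J=T_{p}\{h=0\}$. Moreover $J$ is nilpotent if and only if $\langle\nabla h(p),Z(p)\rangle=0$, and in that case, for $q_{0}$ spanning $T_{p}\{h=0\}$, the Bogdanov--Takens coefficients of $X$ at $p$ associated with $q_0$ are $$a=0,\qquad b=\langle Z(p),\,D^{2}h(p)\,q_{0}\rangle+\langle \nabla h(p),\,DZ(p)\,q_{0}\rangle .$$ More generally, if $X$ is any $C^2$ planar vector field with $DX(p)$ nilpotent of rank one and a regular $C^{1}$ curve of equilibria of $X$ passes through $p$, then $a=0$.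
   Context: $D^2h(p)$ denotes the Hessian matrix. Bogdanov--Takens coefficients of a $C^2$ planar field $X$ at an equilibrium $p$ with $J=DX(p)$ nilpotent of rank one, associated with $q_0$ spanning $\ker J$: put $B(u,v)=D^2X(p)[u,v]$, choose $(q_1,p_0,p_1)$ with $Jq_1=q_0$, $J^{\top}p_1=0$, $J^{\top}p_0=p_1$, $\langle q_0,p_0\rangle=\langle q_1,p_1\rangle=1$, $\langle q_0,p_1\rangle=\langle q_1,p_0\rangle=0$, and set $a=\tfrac12\langle p_1,B(q_0,q_0)\rangle$, $b=\langle p_0,B(q_0,q_0)\rangle+\langle p_1,B(q_0,q_1)\rangle$. These depend only on $X$ and $q_0$; replacing $q_0$ by $cq_0$ multiplies both by $c$. *)

(* Defs.v *)
From mathcomp Require Export all_boot all_order all_algebra.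
From mathcomp Require Export all_classical all_reals all_analysis.

Set Implicit Arguments.
Unset Strict Implicit.
Unset Printing Implicit Defensive.

Export Order.TTheory GRing.Theory Num.Theory.
Export numFieldNormedType.Exports.

Open Scope classical_set_scope.
Open Scope ring_scope.

(* f is of class C^k on a neighbourhood of p. The continuity of the derivative
   is required separately in each direction v, which amounts to continuity in
   operator norm because this is only used for U = R and U = 'cV[R]_2. *)
Fixpoint Ck_near (R : realType) (U V : normedModType R) (k : nat)
    (f : U -> V) (p : U) : Prop :=
  match k with
  | 0 => \forall x \near p, {for x, continuous f}
  | k'.+1 => (\forall x \near p, differentiable f x) /\
             (forall v : U, Ck_near k' (fun x => 'd f x v) p)
  end.

Section Planar.
Variable R : realType.
Local Notation vec := 'cV[R]_2.

Definition dotv (u v : vec) : R := \sum_i u i 0 * v i 0.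

Definition basis_vec (i : 'I_2) : vec := delta_mx i 0.

Definition gradient (h : vec -> R) (p : vec) : vec :=
  \col_i 'd h p (basis_vec i).

Definition hessian (h : vec -> R) (p : vec) : 'M[R]_2 :=
  \matrix_(i, j) 'd (fun x => 'd h x (basis_vec j)) p (basis_vec i).

(* The Jacobian matrix acting on column vectors; the library's 'J f p is the
   transposed matrix, for maps between row vectors. *)
Definition jacobian_mx (X : vec -> vec) (p : vec) : 'M[R]_2 :=
  \matrix_(i, j) ('d X p (basis_vec j)) i 0.

(* D^2X(p)[u, v] *)
Definition second_diff (X : vec -> vec) (p u v : vec) : vec :=
  'd (fun x => 'd X x v) p u.

Definition nilpotent_mx (J : 'M[R]_2) : Prop := exists k : nat, J ^+ k = 0.

(* The kernel for the action on column vectors (kermx is the left kernel). *)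
Definition col_kernel (J : 'M[R]_2) : set vec := [set v | J *m v = 0].

(* The velocities at p of the C^1 curves running in S. *)
Definition tangent_space (S : set vec) (p : vec) : set vec :=
  [set v | exists gamma : R -> vec,
     [/\ Ck_near 1 gamma 0, gamma 0 = p,
         (\forall t \near 0, S (gamma t)) & derive1 gamma 0 = v]].

Definition spans_line (q : vec) (L : set vec) : Prop :=
  L = range (fun c : R => c *: q).

Definition BT_frame (J : 'M[R]_2) (q0 q1 p0 p1 : vec) : Prop :=
  [/\ J *m q1 = q0, J^T *m p1 = 0 & J^T *m p0 = p1] /\
  [/\ dotv q0 p0 = 1, dotv q1 p1 = 1, dotv q0 p1 = 0 & dotv q1 p0 = 0].

(* (a, b) are the Bogdanov-Takens coefficients of X at p associated with q0.
   The pair does not depend on the frame (q1, p0, p1), so this relation is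
   functional in (a, b). *)
Definition is_BT_coeffs (X : vec -> vec) (p q0 : vec) (a b : R) : Prop :=
  let J := jacobian_mx X p in
  let B := second_diff X p in
  [/\ Ck_near 2 X p, X p = 0, nilpotent_mx J, \rank J = 1%N &
      spans_line q0 (col_kernel J)] /\
  exists q1 p0 p1 : vec,
    [/\ BT_frame J q0 q1 p0 p1,
        a = 2^-1 * dotv p1 (B q0 q0) &
        b = dotv p0 (B q0 q0) + dotv p1 (B q0 q1)].

(* A regular C^1 curve of equilibria of X passing through p (at time 0). *)
Definition regular_curve_of_equilibria (X : vec -> vec) (p : vec)
    (gamma : R -> vec) : Prop :=
  [/\ Ck_near 1 gamma 0, gamma 0 = p,
      (\forall t \near 0, derive1 gamma t != 0) &
      (\forall t \near 0, X (gamma t) = 0)].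

End Planar.

(* Main.v *)
From HB Require Import structures.
From mathcomp Require Import lra.
Require Import Defs.

Set Implicit Arguments.
Unset Strict Implicit.
Unset Printing Implicit Defensive.

(* At a zero of h the product rule gives DX(p) = Z(p) n^T with n = grad h(p),
   a rank-one matrix whose square is <n, Z(p)> DX(p), and
   B(u, v) = D^2h(p)[u, v] Z + <n, v> DZ u + <n, u> DZ v; evaluating on a
   frame gives a and b.  A vector v orthogonal to n is the velocity of the curve
   p + t v + s(t) n in {h = 0}, where s is the implicit function.  For a C^1
   curve gamma of equilibria, DX(gamma(t)) gamma'(t) = 0; pairing with p1, which
   annihilates the range of DX(p), dividing by t and letting t tend to 0 gives
   <p1, B(gamma'(0), gamma'(0))> = 0 without differentiating gamma twice. *)

(** * Differentials of germs and of scalar multiples of a map *)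

Section NormedCalculus.
Context {R : realType} {V W : normedModType R}.

(** A little-o at [x] sees only the germ, so the first-order expansion of [f] is also one of [g],
    and such an expansion determines the differential. *)
Lemma near_eq_is_diff (f g df : V -> W) (x : V) :
  (\forall y \near x, f y = g y) -> is_diff x f df -> is_diff x g df.
Proof.
move=> fg [fx <-]; have /diff_locallyP[cd fE] := fx.
have gE : g \o shift x = cst (g x) + 'd f x +o_ 0 id.
  apply/eqaddoP => e e0; move/eqaddoP : fE => /(_ e e0).
  have : \forall y \near (0 : V), f (y + x) = g (y + x).
    by move: fg; rewrite (near_shift 0)/= subr0.
  apply: filterS2 => y fgy; rewrite /= !fctE /=.
  by rewrite fgy (nbhs_singleton fg).
have dg : 'd g x = 'd f x :> (V -> W) := diff_unique cd gE.
split=> //; apply/diff_locallyP.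
by split; rewrite dg.
Qed.

Let scale_is_bilinear : bilinear_for
  (GRing.Scale.Law.clone _ _ *:%R _) (GRing.Scale.Law.clone _ _ *:%R _)
  (fun (k : R) (w : W) => k *: w).
Proof.
split=> [w|k] a x y /=; first by rewrite scalerDl scalerA.
by rewrite scalerDr !scalerA mulrC.
Qed.

(** Chain rule for the pair [(k, f)] followed by scaling, which is bilinear and continuous. *)
Lemma is_diff_scale (k dk : V -> R) (f df : V -> W) (x : V) :
  is_diff x k dk -> is_diff x f df ->
  is_diff x (fun y => k y *: f y) (fun v => dk v *: f x + k x *: df v).
Proof.
move=> kx fx.
pose s (k : R) (w : W) := k *: w.
pose S : {bilinear R -> W -> W} := HB.pack s (bilinear_isBilinear.Build R R W W _ _ s scale_is_bilinear).
have Sc : continuous (fun q : R * W => S q.1 q.2) by exact: scale_continuous.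
have dS : is_diff (k x, f x) (fun q => S q.1 q.2)
    (fun q => S (k x) q.2 + S q.1 (f x)).
  by apply: DiffDef; [exact: differentiable_bilin|exact: diff_bilin].
have dkf := is_diff_pair kx fx.
have := is_diff_comp dkf dS.
rewrite /comp /= => H; apply: is_diff_eq.
by apply/funext => v /=; rewrite addrC.
Qed.

End NormedCalculus.

(** * Stability of the class C^k under local equality, sums and products *)

Section Ck.
Context {R : realType}.

(** Equality near [p] is also equality near each point close to [p], so it passes to the
    differentials and the induction on [k] goes through. *)
Lemma near_Ck_near (U V : normedModType R) (k : nat) (f g : U -> V) (p : U) :
  (\forall x \near p, f x = g x) -> Ck_near k f p -> Ck_near k g p.
Proof.
elim: k f g => [|k IH] f g fg /=.
  move: fg => /near_join; apply: filterS2 => x fg fx.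
  rewrite /prop_for/= /continuous_at -(nbhs_singleton fg).
  by apply: cvg_trans fx; exact: near_eq_cvg.
move/near_join : fg => fg [df cf]; split.
  apply: filterS2 fg df => x fg fx.
  by have [] := near_eq_is_diff fg (differentiableP fx).
move=> v; apply: IH (cf v).
apply: filterS2 fg df => x fg fx.
by have [_ ->] := near_eq_is_diff fg (differentiableP fx).
Qed.

Lemma Ck_nearW (U V : normedModType R) (k : nat) (f : U -> V) (p : U) :
  Ck_near k.+1 f p -> Ck_near k f p.
Proof.
elim: k f => [|k IH] f [df cf].
  by apply: filterS df => x; exact: differentiable_continuous.
by split=> // v; apply: IH; exact: cf.
Qed.

Lemma Ck_nearD (U V : normedModType R) (k : nat) (f g : U -> V) (p : U) :
  Ck_near k f p -> Ck_near k g p -> Ck_near k (fun x => f x + g x) p.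
Proof.
elim: k f g => [|k IH] f g /=.
  by apply: filterS2 => x; exact: continuousD.
move=> [df cf] [dg cg]; split.
  by apply: filterS2 df dg => x; exact: differentiableD.
move=> v; apply: near_Ck_near (IH _ _ (cf v) (cg v)).
by apply: filterS2 df dg => x fx gx; rewrite [in RHS]diffD.
Qed.

Lemma Ck_nearZ (U V : normedModType R) (k : nat) (h : U -> R) (f : U -> V)
    (p : U) :
  Ck_near k h p -> Ck_near k f p -> Ck_near k (fun x => h x *: f x) p.
Proof.
elim: k h f => [|k IH] h f hk fk.
  by apply: filterS2 hk fk => x; exact: continuousZ.
have [dh ch] := hk; have [df cf] := fk.
have dhf : \forall x \near p, is_diff x (fun x => h x *: f x)
    (fun v => 'd h x v *: f x + h x *: 'd f x v).
  apply: filterS2 dh df => x hx fx.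
  by apply: is_diff_scale; exact: differentiableP.
split; first by apply: filterS dhf => x [].
move=> v; apply: (@near_Ck_near _ _ _
  (fun x => 'd h x v *: f x + h x *: 'd f x v)).
  by apply: filterS dhf => x [_ ->].
apply: Ck_nearD; apply: IH; [exact: ch| | |exact: cf].
  exact: Ck_nearW fk.
exact: Ck_nearW hk.
Qed.

End Ck.

(** * An implicit function theorem for level sets *)

Section LevelCurve.
Context {R : realType} {U : normedModType R}.

Lemma diff_MVT (h : U -> R) (x w : U) :
  (forall t : R, 0 <= t <= 1 -> differentiable h (x + t *: w)) ->
  exists2 t : R, 0 <= t <= 1 & h (x + w) - h x = 'd h (x + t *: w) w.
Proof.
move=> dh; pose f (t : R) := h (x + t *: w).
have df (t : R) : 0 <= t <= 1 -> is_diff t f (fun s : R => 'd h (x + t *: w) (s *: w)).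
  move=> t01.
  have dl : is_diff t (fun s : R => x + s *: w) (fun s : R => s *: w).
    by apply: is_diff_eq; rewrite add0r.
  exact: (is_diff_comp dl (differentiableP (dh t t01))).
have df1 (t : R) : t \in `]0, 1[%R -> is_derive t 1 f ('d h (x + t *: w) w).
  rewrite in_itv/= => /andP[t0 t1].
  have [|ft dft] := df t; first by rewrite !ltW.
  by apply: DeriveDef; rewrite ?deriveE ?dft ?scale1r//; exact: diff_derivable.
have cf : {within `[0, 1], continuous f}.
  apply: derivable_within_continuous => t; rewrite in_itv/= => t01.
  by apply/derivable1_diffP; have [] := df t t01.
have [c c01 fc] := MVT_segment ler01 df1 cf.
exists c; first by move: c01; rewrite in_itv.
by move: fc; rewrite /f scale1r scale0r addr0 subr0 mulr1.
Qed.


(** In the family [p + t *: v + s *: n] the intermediate value theorem supplies some [s t] for each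
    small [t]. This [s] comes from choice, with no regularity at first; the mean value theorem on
    the level set then makes it C^1. *)
Lemma level_curve (h : U -> R) (p v n : U) :
  Ck_near 1 h p -> 'd h p v = 0 -> 0 < 'd h p n ->
  exists gamma : R -> U, [/\ Ck_near 1 gamma 0, gamma 0 = p,
    (\forall t \near 0, h (gamma t) = h p) & derive1 gamma 0 = v].
Proof.
(* Near [p] the derivative along [n] stays at least [a], half its value at [p], and the one along
   [v], which vanishes at [p], at most [a] in absolute value. Their quotient is thus bounded by
   1. *)
move=> [dh ch] hv hn; pose a := 'd h p n / 2.
have a0 : 0 < a by rewrite divr_gt0.
pose Q z := [/\ differentiable h z, {for z, continuous (fun x => 'd h x v)},
  {for z, continuous (fun x => 'd h x n)}, `|'d h z v| <= a & a <= 'd h z n].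
have nQ : \forall z \near p, Q z.
  have hvp : \forall z \near p, `|'d h z v| <= a.
    have /cvgrPdist_le/(_ _ a0) := nbhs_singleton (ch v).
    by apply: filterS => z; rewrite hv sub0r normrN.
  have hnp : \forall z \near p, a <= 'd h z n.
    have /cvgrPdist_le/(_ _ a0) := nbhs_singleton (ch n).
    apply: filterS => z /ler_normlW; rewrite lerBlDl -lerBlDr.
    by apply: le_trans; rewrite /a; lra.
  near=> z; split; [near: z..]; [exact: dh|exact: ch|exact: ch|exact: hvp|exact: hnp].
have [r /= r0 rQ] : exists2 r : R, 0 < r & forall z, `|p - z| < r -> Q z.
  by have /nbhs_normP[r /= r0 rQ] := nQ; exists r => // z zr; exact: rQ.
pose L := `|v| + `|n|.
have L0 : 0 <= L by rewrite addr_ge0.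
have L1 : 0 < L + 1 by rewrite ltr_wpDl.
(* With this [e] the parameter square [|t|, |s| <= e] is sent into the ball of radius [r] where [Q]
   holds; the added 1 keeps the divisor positive. *)
pose e := r / (L + 1).
have e0 : 0 < e by rewrite divr_gt0.
have eL : e * L < r by rewrite /e mulrAC ltr_pdivrMr// ltr_pM2l// ltrDl.
pose P (t s : R) := p + (t *: v + s *: n).
have PQ t s : `|t| <= e -> `|s| <= e -> Q (P t s).
  move=> te se; apply: rQ; rewrite /P opprD addrA subrr sub0r normrN.
  apply: le_lt_trans eL; rewrite mulrDr (le_trans (ler_normD _ _))//.
  by rewrite !normrZ lerD// ler_wpM2r.
(* The bound on [z - P t s] keeps the intermediate point near [P t s], which later forces the
   difference quotients of [s] to converge. *)
have mvt t s t' s' : `|t| <= e -> `|s| <= e -> `|t'| <= e -> `|s'| <= e ->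
    exists2 z, Q z /\ `|z - P t s| <= `|P t' s' - P t s| &
    h (P t' s') - h (P t s) = (t' - t) * 'd h z v + (s' - s) * 'd h z n.
  move=> te se te' se'; set w := P t' s' - P t s.
  have wE : w = (t' - t) *: v + (s' - s) *: n.
    by rewrite /w /P opprD addrACA subrr add0r opprD addrACA !scalerBl.
  have conv (x y c : R) : `|x| <= e -> `|y| <= e -> 0 <= c <= 1 ->
      `|x + c * (y - x)| <= e.
    rewrite !ler_norml => /andP[x1 x2] /andP[y1 y2] /andP[c1 c2].
    by apply/andP; split; nra.
  have Qw (c : R) : 0 <= c <= 1 -> Q (P t s + c *: w).
    move=> c01; rewrite (_ : _ + _ = P (t + c * (t' - t)) (s + c * (s' - s))).
      by apply: PQ; exact: conv.
    by rewrite wE /P -addrA; congr (_ + _); rewrite scalerDr !scalerA addrACA -!scalerDl.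
  have [|c c01] := @diff_MVT h (P t s) w; first by move=> c /Qw[].
  rewrite (_ : P t s + w = P t' s'); last by rewrite addrC subrK.
  rewrite [X in 'd h _ X]wE linearD !linearZ/= => hw.
  exists (P t s + c *: w) => //; split; first exact: Qw.
  case/andP: c01 => c0 c1; rewrite addrAC subrr add0r normrZ ger0_norm//.
  by rewrite ler_piMl.
have P00 : P 0 0 = p by rewrite /P !scale0r !addr0.
have ee : `|e| <= e by rewrite gtr0_norm.
have eNe : `|- e| <= e by rewrite normrN.
have z0e : `|0 : R| <= e by rewrite normr0 ltW.
(* In the increment of [h] from [p] to [P t e] or [P t (- e)], the part along [v] is at most [e * a]
   in size and the part along [n] at least that, so [h p] lies between the two values. The condition
   on [t] sits under the existential so that [choice] gives a function on all of [R]. *)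
have exs t : exists s, `|t| <= e -> `|s| <= e /\ h (P t s) = h p.
  have [te|_] := boolP (`|t| <= e); last by exists 0.
  have up : h p <= h (P t e).
    have [z [[_ _ _ zv zn] _]] := mvt 0 0 t e z0e z0e te ee.
    rewrite P00 !subr0 -subr_ge0 => ->.
    move: te zv; rewrite !ler_norml => /andP[? ?] /andP[? ?]; nra.
  have lo : h (P t (- e)) <= h p.
    have [z [[_ _ _ zv zn] _]] := mvt 0 0 t (- e) z0e z0e te eNe.
    rewrite P00 !subr0 -subr_le0 => ->.
    move: te zv; rewrite !ler_norml => /andP[? ?] /andP[? ?]; nra.
  have cP : {within `[- e, e], continuous (fun s => h (P t s))}.
    apply: derivable_within_continuous => s; rewrite in_itv/= -ler_norml => se.
    apply/derivable1_diffP; apply: differentiable_comp.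
      by rewrite /P; apply: differentiableD => //; apply: differentiableD.
    by have [] := PQ t s te se.
  have [||s] := @IVT _ _ (- e) e (h p) _ cP.
  - lra.
  - by rewrite ge_min lo le_max up orbT.
  by rewrite in_itv/= -ler_norml => se hs; exists s.
have {exs}[s sP] := choice exs.
pose gamma t := P t (s t).
pose phi z := 'd h z v / 'd h z n.
(* With phi = 'd h _ v / 'd h _ n, the mean value theorem between two points of
   the level set yields at once that s is 1-Lipschitz and that s' = - phi. *)
have slope t t' : `|t| <= e -> `|t'| <= e ->
    exists2 z, Q z /\ `|z - gamma t| <= `|gamma t' - gamma t| &
    s t' - s t = - phi z * (t' - t).
  move=> te te'; have [ste hst] := sP _ te; have [ste' hst'] := sP _ te'.
  have [z Qz] := mvt t (s t) t' (s t') te ste te' ste'.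
  rewrite hst hst' subrr => /eqP; rewrite eq_sym addrC addr_eq0 => /eqP zE.
  exists z => //; have [[_ _ _ _ zn] _] := Qz.
  have zn0 : 'd h z n != 0 by rewrite gt_eqF// (lt_le_trans a0).
  by apply: (mulIf zn0); rewrite zE /phi mulrAC !mulNr divfK// mulrC.
have phi1 z : Q z -> `|phi z| <= 1.
  move=> [_ _ _ zv zn]; have zn0 := lt_le_trans a0 zn.
  rewrite /phi normrM normfV (gtr0_norm zn0) ler_pdivrMr// mul1r.
  exact: le_trans zv zn.
have lip t t' : `|t| <= e -> `|t'| <= e ->
    `|gamma t' - gamma t| <= L * `|t' - t|.
  move=> te te'; have [z [Qz _] zE] := slope _ _ te te'.
  rewrite /gamma /P opprD addrACA subrr add0r opprD addrACA -!scalerBl.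
  rewrite (le_trans (ler_normD _ _))// !normrZ /L mulrDl mulrC lerD//.
  rewrite mulrC ler_wpM2l// zE normrM normrN.
  by rewrite ler_piMl// phi1.
have cphi z : Q z -> {for z, continuous phi}.
  move=> [_ cv cn _ zn]; apply: continuousM => //.
  by apply: continuousV => //; rewrite gt_eqF// (lt_le_trans a0).
have gQ t : `|t| <= e -> Q (gamma t) by move=> te; apply: PQ => //; have [] := sP t te.
(* Between [P 0 0] and [P 0 (s 0)] the increment of [h] is zero, yet it is [s 0] times a positive
   derivative. *)
have s0 : s 0 = 0.
  have [ste hst] := sP _ z0e.
  have [z [[_ _ _ _ zn] _]] := mvt 0 0 0 (s 0) z0e z0e z0e ste.
  rewrite hst P00 !subrr !subr0 mul0r add0r => /esym/eqP.
  by rewrite mulf_eq0 (gt_eqF (lt_le_trans a0 zn)) orbF => /eqP.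
(* The difference quotient of [s] is [- phi z] for some [z] within [L * |k|] of [gamma t], and [phi]
   is continuous at [gamma t]. *)
have ds (t : R) : `|t| < e -> is_derive t 1 s (- phi (gamma t)).
  move=> te.
  suff H : (fun k => k^-1 *: (s (k *: 1 + t) - s t)) @ 0^' --> - phi (gamma t).
    by apply: DeriveDef; [apply/cvg_ex; eexists; exact: H|exact/cvg_lim].
  apply/cvgrPdist_le => eps eps0.
  have /cvgrPdist_le/(_ _ eps0) := cphi _ (gQ _ (ltW te)).
  move=> /nbhs_normP[d /= d0 dP].
  have k1 : \forall k \near (0 : R)^', `|k + t| <= e.
    have et : 0 < e - `|t| by rewrite subr_gt0.
    near=> k; rewrite (le_trans (ler_normD _ _))// -lerBrDr.
    by near: k; apply: filterS (dnbhs0_lt et) => k /ltW.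
  have k2 : \forall k \near (0 : R)^', L * `|k| < d.
    have dL : 0 < d / (L + 1) by rewrite divr_gt0.
    apply: filterS (dnbhs0_lt dL) => k; rewrite ltr_pdivlMr// mulrC.
    by apply: le_lt_trans; rewrite ler_wpM2r// lerDl.
  near=> k.
  have k0 : k != 0 by near: k; exact: nbhs_dnbhs_neq.
  have kt : `|k + t| <= e by near: k.
  rewrite [k *: 1]mulr1.
  have [z [Qz zg] ->] := slope t (k + t) (ltW te) kt.
  rewrite addrK [_ *: _]mulrCA mulVf// mulr1 opprK addrC -normrN opprB.
  apply: dP; rewrite /= distrC (le_lt_trans zg)// (le_lt_trans (lip _ _ (ltW te) kt))//.
  by rewrite addrK; near: k.
have dgamma (t : R) : `|t| < e ->
    is_diff t gamma (fun k => k *: (v - phi (gamma t) *: n)).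
  move=> te; have [dst dsE] := ds t te.
  have ds1 : is_diff t s (fun k => k *: - phi (gamma t)).
    have st : differentiable s t by exact/derivable1_diffP.
    by apply: DiffDef => //; rewrite diff1E// derive1E dsE.
  have H : is_diff t gamma (0 + ( *:%R^~ v + (fun k => (k *: - phi (gamma t)) *: n))).
    have sn : is_diff t (fun t => s t *: n) (fun k => (k *: - phi (gamma t)) *: n).
      apply: is_diff_eq (is_diff_scale ds1 (is_diff_cst n t)) _.
      by apply/funext => k /=; rewrite scaler0 addr0.
    exact: is_diffD.
  apply: is_diff_eq; apply/funext => k; rewrite !fctE/= add0r.
  by rewrite scalerN scaleNr scalerBr; congr (_ - _); rewrite [RHS]scalerA.
have ne : \forall t \near (0 : R), `|t| < e.
  by apply/nbhs_normP; exists e => //= t /=; rewrite sub0r normrN.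
exists gamma; split.
- split; first by apply: filterS ne => t /dgamma[].
  move=> k; apply: (@near_Ck_near _ _ _ 0
    (fun t => k *: (v - phi (gamma t) *: n)) (fun t => 'd gamma t k)).
    by apply: filterS ne => t /dgamma[_ ->].
  apply: filterS ne => t te; have [dt _] := dgamma t te.
  apply: cvgZ; first exact: cvg_cst.
  apply: cvgB; first exact: cvg_cst.
  apply: cvgZ; last exact: cvg_cst.
  apply: continuous_comp.
    exact: differentiable_continuous.
  exact/cphi/gQ/ltW.
- by rewrite /gamma s0 P00.
- by apply: filterS ne => t /ltW/sP[].
(* Since ['d h p v = 0], [phi] vanishes at [p] and the velocity there is exactly [v]. *)
have [d0 dE] := dgamma 0 (ltac: (by rewrite normr0)).
by rewrite derive1E' // dE scale1r /gamma s0 P00 /phi hv mul0r scale0r subr0.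
Unshelve. all: by end_near. Qed.

End LevelCurve.

(** * Rank-one matrices and Bogdanov-Takens frames *)

Section PlanarAlgebra.
Context {R : realType}.
Implicit Types (u v w z n : 'cV[R]_2) (J : 'M[R]_2).

Lemma dotvE u v : dotv u v = (u^T *m v) 0 0.
Proof. by rewrite mxE; apply: eq_bigr => i _; rewrite mxE. Qed.

Lemma dotvC u v : dotv u v = dotv v u.
Proof. by apply: eq_bigr => i _; rewrite mulrC. Qed.

Lemma dotvDr u v w : dotv u (v + w) = dotv u v + dotv u w.
Proof. by rewrite !dotvE mulmxDr mxE. Qed.

Lemma dotvZr u c v : dotv u (c *: v) = c * dotv u v.
Proof. by rewrite !dotvE -scalemxAr mxE. Qed.

Lemma dotvZl u c v : dotv (c *: u) v = c * dotv u v.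
Proof. by rewrite dotvC dotvZr dotvC. Qed.

Lemma dotv0 u : dotv u 0 = 0.
Proof. by rewrite -(scale0r 0) dotvZr mul0r. Qed.

Lemma dotv_mulmx u J v : dotv u (J *m v) = dotv (J^T *m u) v.
Proof. by rewrite !dotvE trmx_mul trmxK mulmxA. Qed.

Lemma dotvv_gt0 u : u != 0 -> 0 < dotv u u.
Proof.
move=> u0; have u2 i : 0 <= u i 0 * u i 0 by rewrite -expr2 sqr_ge0.
rewrite lt_neqAle sumr_ge0// andbT eq_sym psumr_eq0//.
apply: contra u0 => /allP uu0; apply/eqP/matrixP => i j.
by have := uu0 i (mem_index_enum i); rewrite ord1 mxE mulf_eq0 orbb => /eqP.
Qed.

Lemma col_sum_basis v : v = \sum_i v i 0 *: basis_vec R i.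
Proof.
rewrite [LHS]matrix_sum_delta; apply: eq_bigr => i _.
by rewrite big_ord1.
Qed.

Lemma mul_rank1 z n v : z *m n^T *m v = dotv n v *: z.
Proof.
by rewrite -mulmxA [n^T *m v]mx11_scalar -dotvE mul_mx_scalar.
Qed.

Lemma trmx_mul_rank1 z n v : (z *m n^T)^T *m v = dotv z v *: n.
Proof. by rewrite trmx_mul trmxK mul_rank1. Qed.

Lemma rank1_neq0 z n : z != 0 -> n != 0 -> z *m n^T != 0.
Proof.
move=> z0 n0; apply/eqP => /(congr1 (mulmx^~ n)) /eqP.
by rewrite mul0mx mul_rank1 scaler_eq0 (negPf z0) gt_eqF ?dotvv_gt0.
Qed.

Lemma mxrank_rank1 z n : z != 0 -> n != 0 -> \rank (z *m n^T) = 1%N.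
Proof.
move=> z0 n0; apply/eqP; rewrite eqn_leq lt0n mxrank_eq0 rank1_neq0// andbT.
exact: leq_trans (mxrankM_maxl _ _) (rank_leq_col _).
Qed.

(** The factorization [col_base J *m row_base J] has inner dimension 1. *)
Lemma rank1_decomp J : \rank J = 1%N ->
  exists z n, [/\ J = z *m n^T, z != 0 & n != 0].
Proof.
move=> J1; have := mulmx_base J.
move: (col_base J) (row_base J); rewrite J1 => z n JE.
have J0 : J != 0 by rewrite -mxrank_eq0 J1.
exists z, n^T; rewrite trmxK JE; split=> //; apply: contra J0 => /eqP.
  by move=> z0; rewrite -JE z0 mul0mx.
by move=> /(canRL (@trmxK _ _ _)); rewrite trmx0 => n0; rewrite -JE n0 mulmx0.
Qed.

(** The vector [z] is an eigenvector of [z *m n^T] with eigenvalue [dotv n z], so a vanishing power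
    kills the eigenvalue. Conversely the square of the matrix is [dotv n z] times itself. *)
Lemma nilpotent_rank1 z n : z != 0 -> n != 0 ->
  nilpotent_mx (z *m n^T) <-> dotv n z = 0.
Proof.
move=> z0 n0; split=> [[k Jk]|nz]; last first.
  by exists 2%N; rewrite expr2 -[LHS]/(_ *m _) mulmxA mul_rank1 nz scale0r mul0mx.
have Jkz m : (z *m n^T) ^+ m *m z = dotv n z ^+ m *: z.
  elim: m => [|m IH]; first by rewrite !expr0 mul1mx scale1r.
  rewrite exprSr -[_ * _]/(_ *m _) -mulmxA mul_rank1 -scalemxAr IH.
  by rewrite scalerA exprS.
have := Jkz k; rewrite Jk mul0mx => /esym/eqP.
rewrite scaler_eq0 (negPf z0) orbF expf_eq0 => /andP[_ /eqP //].
Qed.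

Lemma col_kernel_rank1 z n : z != 0 ->
  col_kernel (z *m n^T) = [set v | dotv n v = 0].
Proof.
move=> z0; apply/seteqP; split=> v; rewrite /col_kernel/= mul_rank1.
  by move/eqP; rewrite scaler_eq0 (negPf z0) orbF => /eqP.
by move=> ->; rewrite scale0r.
Qed.

(** Nilpotency puts [z] in the kernel, the orthogonal of [n], so [z = c *: q0]; the frame is built
    from the orthogonal vectors [n] and [q0]. *)
Lemma BT_frame_exists J q0 : nilpotent_mx J -> \rank J = 1%N ->
  spans_line q0 (col_kernel J) ->
  exists q1 p0 p1, BT_frame J q0 q1 p0 p1.
Proof.
move=> nJ /rank1_decomp[z [n [JE z0 n0]]]; move: nJ; rewrite {J}JE.
move=> /(nilpotent_rank1 z0 n0) nz; rewrite /spans_line col_kernel_rank1// => kE.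
have [c _ cz] : range (fun c : R => c *: q0) z by rewrite -kE.
have nq : dotv n q0 = 0.
  have : [set v | dotv n v = 0] q0 by rewrite kE; exists 1; rewrite ?scale1r.
  by [].
have c0 : c != 0 by apply: contra z0 => /eqP c0; rewrite -cz c0 scale0r.
have q00 : q0 != 0 by apply: contra z0 => /eqP qe; rewrite -cz qe scaler0.
have nn := dotvv_gt0 n0; have qq := dotvv_gt0 q00.
have nn0 := lt0r_neq0 nn; have qq0 := lt0r_neq0 qq.
(* The scalars are forced in turn: [J q1 = dotv n q1 *: z] must equal [q0], [p0] must pair to 1 with
   [q0], and [p1 = J^T p0 = dotv z p0 *: n]. *)
exists ((c * dotv n n)^-1 *: n), ((dotv q0 q0)^-1 *: q0), (c *: n).
split; split.
- rewrite mul_rank1 dotvZr -cz scalerA -mulrA [_ * c]mulrC.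
  by rewrite mulVf ?mulf_neq0// scale1r.
- by rewrite trmx_mul_rank1 dotvZr [dotv z n]dotvC nz mulr0 scale0r.
- by rewrite trmx_mul_rank1 dotvZr -cz dotvZl mulrCA mulVf// mulr1.
- by rewrite dotvZr mulVf.
- by rewrite dotvZl dotvZr invfM mulrACA mulVf// mul1r mulVf.
- by rewrite dotvZr dotvC nq mulr0.
- by rewrite dotvZl dotvZr nq !mulr0.
Qed.

End PlanarAlgebra.

(** * Gradient, Jacobian and Hessian as coordinates of differentials *)

Section PlanarCalculus.
Context {R : realType}.
Local Notation vec := 'cV[R]_2.

Lemma diff_sum_basis (W : normedModType R) (f : vec -> W) (p v : vec) :
  'd f p v = \sum_i v i 0 *: 'd f p (basis_vec R i).
Proof.
by rewrite {1}[v]col_sum_basis linear_sum; apply: eq_bigr => i _; rewrite linearZ.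
Qed.

Lemma diff_gradient (h : vec -> R) (p v : vec) :
  'd h p v = dotv (gradient h p) v.
Proof.
by rewrite diff_sum_basis; apply: eq_bigr => i _; rewrite mxE mulrC.
Qed.

Lemma mul_jacobian_mx (X : vec -> vec) (p v : vec) :
  jacobian_mx X p *m v = 'd X p v.
Proof.
rewrite diff_sum_basis; apply/matrixP => i j; rewrite ord1 mxE summxE.
by apply: eq_bigr => k _; rewrite !mxE mulrC.
Qed.

(** The expansion of [v] in the basis holds under ['d f x] for every [x], so it can be
    differentiated in [x] term by term. This makes second differentials linear in the inner
    direction. *)
Lemma diff_dir_sum (W : normedModType R) (f : vec -> W) (p u v : vec) :
  (forall w, differentiable (fun x => 'd f x w) p) ->
  'd (fun x => 'd f x v) p u =
  \sum_i v i 0 *: 'd (fun x => 'd f x (basis_vec R i)) p u.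
Proof.
move=> df; have sumE (F : 'I_2 -> W) : \sum_i F i = F 0 + F 1.
  by rewrite big_ord_recl big_ord1; congr (_ + F _); exact: val_inj.
have dfi i : is_diff p (fun x => v i 0 *: 'd f x (basis_vec R i))
    (fun u => v i 0 *: 'd (fun x => 'd f x (basis_vec R i)) p u).
  exact/is_diffZ/differentiableP.
have [_ /(congr1 (fun F => F u)) dE] := is_diffD (dfi 0) (dfi 1).
rewrite sumE -[RHS]dE; congr ('d _ p u); apply/funext => x.
exact: etrans (diff_sum_basis f x v) (sumE _).
Qed.

Lemma diff_dirZr (W : normedModType R) (f : vec -> W) (p u v : vec) (c : R) :
  (forall w, differentiable (fun x => 'd f x w) p) ->
  'd (fun x => 'd f x (c *: v)) p u = c *: 'd (fun x => 'd f x v) p u.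
Proof.
move=> df; apply: etrans (diff_dir_sum u (c *: v) df) _.
apply: etrans (congr1 (GRing.scale c) (esym (diff_dir_sum u v df))).
by rewrite scaler_sumr; apply: eq_bigr => i _; rewrite mxE scalerA.
Qed.

Lemma dotv_hessian (h : vec -> R) (p u v : vec) :
  (forall w, differentiable (fun x => 'd h x w) p) ->
  dotv u (hessian h p *m v) = 'd (fun x => 'd h x v) p u.
Proof.
move=> dh; rewrite [RHS]diff_sum_basis; apply: eq_bigr => i _.
rewrite mxE; congr (_ * _); apply: etrans (esym (diff_dir_sum _ v dh)).
by apply: eq_bigr => j _; rewrite mxE mulrC.
Qed.

(** The product rule gives the first differential on a whole neighbourhood of [p], where it is a sum
    of two products to which the rule applies again. *)
Lemma second_diff_scale (h : vec -> R) (Z : vec -> vec) (p u v : vec) :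
  Ck_near 2 h p -> Ck_near 2 Z p ->
  second_diff (fun x => h x *: Z x) p u v =
  'd (fun x => 'd h x v) p u *: Z p + 'd h p v *: 'd Z p u +
  ('d h p u *: 'd Z p v + h p *: second_diff Z p u v).
Proof.
move=> [dh ch] [dZ cZ].
have dhp := differentiableP (nbhs_singleton dh).
have dZp := differentiableP (nbhs_singleton dZ).
have dhv := differentiableP (nbhs_singleton (ch v).1).
have dZv := differentiableP (nbhs_singleton (cZ v).1).
have H : is_diff p (fun x => 'd h x v *: Z x + h x *: 'd Z x v) _ :=
  is_diffD (is_diff_scale dhv dZp) (is_diff_scale dhp dZv).
have E : \forall x \near p, 'd h x v *: Z x + h x *: 'd Z x v =
    'd (fun x => h x *: Z x) x v.
  apply: filterS2 dh dZ => x hx Zx.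
  have [_ /(congr1 (fun F => F v)) dE] :=
    is_diff_scale (differentiableP hx) (differentiableP Zx).
  exact: esym dE.
have [_ /(congr1 (fun F => F u)) dE] := near_eq_is_diff E H.
exact: dE.
Qed.

End PlanarCalculus.

(** * The second differential along a curve of equilibria *)

Section BT.
Context {R : realType}.
Local Notation vec := 'cV[R]_2.
Implicit Types (p q v w z : vec).

Lemma cvg_sum_ord (W : normedModType R) (T : Type) (F : set_system T)
    {FF : Filter F} n (f : 'I_n -> T -> W) (l : 'I_n -> W) :
  (forall i, f i x @[x --> F] --> l i) ->
  \sum_i f i x @[x --> F] --> \sum_i l i.
Proof.
by move=> fl; apply: cvg_big; first exact: add_continuous.
Qed.

Lemma dotv_continuous (u : vec) : continuous (dotv u).
Proof.
move=> w; rewrite /continuous_at /dotv.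
apply: (@cvg_sum_ord R _ (nbhs w)) => i; apply: cvgM; first exact: cvg_cst.
exact: (@coord_continuous R 2 1 i 0 w).
Qed.

(** By the chain rule this is the derivative at [t] of [f \o gamma], which agrees with the zero
    function near [t]. *)
Lemma diff_along_zeros (U W : normedModType R) (f : U -> W) (gamma : R -> U)
    (t : R) :
  differentiable gamma t -> differentiable f (gamma t) ->
  (\forall s \near t, f (gamma s) = 0) ->
  'd f (gamma t) ('d gamma t 1) = 0.
Proof.
move=> dg df fg0.
have [_ /(congr1 (fun F => F 1)) dE] :=
  is_diff_comp (differentiableP dg) (differentiableP df).
have fgc : \forall s \near t, cst 0 s = (f \o gamma) s.
  by apply: filterS fg0 => s /= ->.
have [_ dE0] := near_eq_is_diff fgc (is_diff_cst (0 : W) t).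
exact: etrans (esym dE) (congr1 (fun F => F 1) dE0).
Qed.

Lemma sum_basis_linearB (W : normedModType R) (f g : {linear vec -> W}) (c : R)
    (v : vec) :
  \sum_i v i 0 *: (c *: (f (basis_vec R i) - g (basis_vec R i))) =
  c *: (f v - g v).
Proof.
rewrite [in RHS](col_sum_basis v) (linear_sum f) (linear_sum g) -sumrB scaler_sumr.
by apply: eq_bigr => i _; rewrite !linearZ -scalerDr.
Qed.

Lemma second_diff_equilibria (X : vec -> vec) (p p1 : vec) (gamma : R -> vec) :
  Ck_near 2 X p -> Ck_near 1 gamma 0 -> gamma 0 = p ->
  (\forall t \near 0, X (gamma t) = 0) ->
  (jacobian_mx X p)^T *m p1 = 0 ->
  dotv p1 (second_diff X p (derive1 gamma 0) (derive1 gamma 0)) = 0.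
Proof.
move=> [dX cX] [dg cg] g0 Xg0 p1J.
have dg0 := nbhs_singleton dg.
rewrite derive1E' //; set v := 'd gamma 0 1.
have dXv w : differentiable (fun x => 'd X x w) p by exact: nbhs_singleton (cX w).1.
(* [V t] is [t^-1 (DX(gamma t) - DX(p)) gamma'(t)], expanded in the basis so that the moving vector
   enters only through scalar coordinates and each quotient has a fixed direction. *)
pose V (t : R) := \sum_i ('d gamma t 1) i 0 *:
  (t^-1 *: ('d X (gamma t) (basis_vec R i) - 'd X p (basis_vec R i))).
(* As [DX(gamma t) gamma'(t) = 0], what remains of [V t] lies in the range of [DX(p)], which [p1]
   annihilates. *)
have V0 : \forall t \near 0^', dotv p1 (V t) = 0.
  have gX : \forall t \near 0, differentiable X (gamma t).
    have := differentiable_continuous dg0.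
    by rewrite /prop_for /continuous_at g0 => /(_ _ dX).
  have : \forall t \near 0, 'd X (gamma t) ('d gamma t 1) = 0.
    move/near_join : Xg0 => Xg0.
    apply: filterS3 Xg0 gX dg => t Xgt Xt gt.
    exact: diff_along_zeros.
  move=> H; apply: cvg_within; apply: filterS H => t Xt.
  have -> : V t = t^-1 *: (0 - 'd X p ('d gamma t 1)).
    apply: etrans (sum_basis_linearB ('d X (gamma t)) ('d X p) _ _) _.
    by rewrite [X in _ *: (X - _)]Xt.
  have pX : dotv p1 ('d X p ('d gamma t 1)) = 0.
    by rewrite -mul_jacobian_mx dotv_mulmx p1J dotvC dotv0.
  by rewrite sub0r dotvZr -scaleN1r dotvZr pX !mulr0.
(* The coordinates of [gamma'(t)] converge because [gamma] is C^1, and each quotient tends to the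
   derivative at 0 of [G], computed by the chain rule. *)
have Vlim : V t @[t --> 0^'] --> second_diff X p v v.
  have -> : second_diff X p v v = _ := diff_dir_sum v v dXv.
  apply: cvg_sum_ord => i; apply: cvgZ.
    apply: cvg_within_filter.
    exact: (cvg_comp _ _ (nbhs_singleton (cg 1)) (@coord_continuous R 2 1 i 0 _)).
  pose G t := 'd X (gamma t) (basis_vec R i).
  have dXg : differentiable (fun x => 'd X x (basis_vec R i)) (gamma 0).
    by rewrite g0; exact: dXv.
  have [dG /(congr1 (fun F => F 1)) dGE] : is_diff 0 G _ :=
    is_diff_comp (differentiableP dg0) (differentiableP dXg).
  have GD : derivable G 0 1 by exact: diff_derivable.
  have DE : 'D_1 G 0 = 'd (fun x => 'd X x (basis_vec R i)) p v.
    apply: etrans (deriveE _ dG) _; apply: etrans dGE _.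
    by rewrite /= g0.
  have GE : (fun t : R => t^-1 *: (G (t *: 1 + 0) - G 0)) = fun t : R =>
      t^-1 *: ('d X (gamma t) (basis_vec R i) - 'd X p (basis_vec R i)).
    by apply/funext => t; rewrite [t *: 1]mulr1 addr0 /G g0.
  have Glim : (fun t : R => t^-1 *: (G (t *: 1 + 0) - G 0)) @ 0^' --> 'D_1 G 0 :=
    GD.
  exact: (eq_ind _ (fun F => F @ 0^' --> _) (eq_ind _ (fun l => _ --> l) Glim _ DE) _ GE).
have l1 : (dotv p1 \o V) @ 0^' --> dotv p1 (second_diff X p v v).
  exact: cvg_comp Vlim (@dotv_continuous p1 (second_diff X p v v)).
have l0 : (dotv p1 \o V) @ 0^' --> (0 : R).
  have V0' : {near 0^', cst 0 =1 dotv p1 \o V} by apply: filterS V0 => t /= ->.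
  exact: cvg_trans (near_eq_cvg V0') (cvg_cst 0).
exact: etrans (esym (cvg_lim (@Rhausdorff R) l1)) (cvg_lim (@Rhausdorff R) l0).
Qed.

End BT.

(** * The field [h Z] at a zero of [h] *)

Section Main.
Context {R : realType}.
Local Notation vec := 'cV[R]_2.

(** One inclusion differentiates [h] along a curve of zeros. The other applies [level_curve] with
    the gradient as transverse direction, along which the derivative of [h] is its positive squared
    length. *)
Lemma tangent_space_level (h : vec -> R) (p : vec) :
  Ck_near 1 h p -> h p = 0 -> gradient h p != 0 ->
  tangent_space [set x | h x = 0] p = [set v | dotv (gradient h p) v = 0].
Proof.
move=> hC hp0 n0; apply/seteqP; split=> v /=.
  move=> [gamma [[dg _] g0 hg0 <-]].
  have dg0 := nbhs_singleton dg.
  have dhg : differentiable h (gamma 0).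
    by rewrite g0; exact: nbhs_singleton hC.1.
  rewrite derive1E'// -diff_gradient -g0.
  exact: diff_along_zeros.
rewrite -diff_gradient => hv.
have hn : 0 < 'd h p (gradient h p) by rewrite diff_gradient dotvv_gt0.
have [gamma [gC g0 hg gv]] := level_curve hC hv hn.
exists gamma; split=> //.
by apply: filterS hg => t /= ->.
Qed.

Lemma jacobian_mx_scale (h : vec -> R) (Z : vec -> vec) (p : vec) :
  differentiable h p -> differentiable Z p -> h p = 0 ->
  jacobian_mx (fun x => h x *: Z x) p = Z p *m (gradient h p)^T.
Proof.
move=> dh dZ hp0.
have [_ dE] := is_diff_scale (differentiableP dh) (differentiableP dZ).
apply/matrixP => i j; rewrite [LHS]mxE.
apply: etrans (congr1 (fun F : vec -> vec => F (basis_vec R j) i 0) dE) _.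
by rewrite !mxE big_ord1 !mxE hp0 mul0r addr0 mulrC.
Qed.

(* J q1 = q0 and J^T p0 = p1 force q0 = <n, q1> Z and p1 = <Z, p0> n, with
   <n, q1><Z, p0> = 1, where n is the gradient of h. *)
Lemma BT_scale (h : vec -> R) (Z : vec -> vec) (p q0 q1 p0 p1 : vec) :
  let X := fun x => h x *: Z x in
  Ck_near 2 h p -> Ck_near 2 Z p -> h p = 0 -> gradient h p != 0 ->
  dotv (gradient h p) (Z p) = 0 ->
  BT_frame (Z p *m (gradient h p)^T) q0 q1 p0 p1 ->
  dotv p1 (second_diff X p q0 q0) = 0 /\
  dotv p0 (second_diff X p q0 q0) + dotv p1 (second_diff X p q0 q1) =
    dotv (Z p) (hessian h p *m q0) +
    dotv (gradient h p) (jacobian_mx Z p *m q0).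
Proof.
move=> X hC ZC hp0 n0 nz [[]].
set n := gradient h p in n0 nz *; set z := Z p in nz *.
rewrite mul_rank1 !trmx_mul_rank1 => Jq1 Jp1 Jp0 [q0p0 q1p1 q0p1 q1p0].
set c := dotv n q1 in Jq1; set d := dotv z p0 in Jp0.
have zp1 : dotv p1 z = 0.
  by move/eqP: Jp1; rewrite scaler_eq0 (negPf n0) orbF dotvC => /eqP.
have dc : d * c = 1 by rewrite -q0p0 -Jq1 dotvZl mulrC.
have zq : z = d *: q0 by rewrite -Jq1 scalerA dc scale1r.
have nq0 : dotv n q0 = 0 by rewrite -Jq1 dotvZr nz mulr0.
have dh w : differentiable (fun x => 'd h x w) p by exact: nbhs_singleton (hC.2 w).1.
set H := 'd (fun x => 'd h x q0) p.
have hq0 : 'd h p q0 = 0 by rewrite diff_gradient.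
(* In the product rule for [B(q0, v)] the last two terms carry the factors ['d h p q0 = 0] and
   [h p = 0]. *)
have drop0 (x y w : vec) (a b : R) : a = 0 -> b = 0 -> x + (a *: y + b *: w) = x.
  by move=> -> ->; rewrite !scale0r !addr0.
have B00 : second_diff X p q0 q0 = H q0 *: z.
  apply: etrans (second_diff_scale q0 q0 hC ZC) _; apply: etrans (drop0 _ _ _ _ _ hq0 hp0) _.
  by rewrite -[RHS]addr0; congr (_ + _); rewrite [X in X *: _]hq0 scale0r.
have B01 : second_diff X p q0 q1 =
    'd (fun x => 'd h x q1) p q0 *: z + c *: (jacobian_mx Z p *m q0).
  apply: etrans (second_diff_scale q0 q1 hC ZC) _; apply: etrans (drop0 _ _ _ _ _ hq0 hp0) _.
  congr (_ + _); congr (_ *: _); first exact: diff_gradient.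
  exact/esym/mul_jacobian_mx.
split; first by rewrite B00 dotvZr zp1 mulr0.
have Hz : dotv z (hessian h p *m q0) = d * H q0.
  by apply: etrans (dotv_hessian _ _ dh) _; rewrite -/H [X in H X]zq; exact: linearZ.
(* The term in [D^2h(q0, q1)] drops since [p1] is orthogonal to [z]. Writing [p1 = d *: n], the [DZ]
   term gets the factor [c * d = 1], while [dotv p0 z = d] matches the Hessian term. *)
rewrite B00 B01 Hz dotvDr !dotvZr zp1 mulr0 add0r -{1}Jp0 dotvZl.
by rewrite mulrA [c * d]mulrC dc mul1r [dotv p0 z]dotvC mulrC.
Qed.

End Main.

Theorem proposition2p11 (R : realType) (p : 'cV[R]_2) :
  (forall (h : 'cV[R]_2 -> R) (Z : 'cV[R]_2 -> 'cV[R]_2),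
     Ck_near 2 h p -> Ck_near 2 Z p ->
     h p = 0 -> gradient h p != 0 -> Z p != 0 ->
     let X := fun x => h x *: Z x in
     let J := jacobian_mx X p in
     let T := tangent_space [set x | h x = 0] p in
     [/\ X p = 0,
         J = Z p *m (gradient h p)^T,
         \rank J = 1%N &
         col_kernel J = T] /\
     (nilpotent_mx J <-> dotv (gradient h p) (Z p) = 0) /\
     (nilpotent_mx J ->
      forall q0 : 'cV[R]_2, spans_line q0 T ->
      forall a b : R,
        is_BT_coeffs X p q0 a b <->
        a = 0 /\
        b = dotv (Z p) (hessian h p *m q0) +
            dotv (gradient h p) (jacobian_mx Z p *m q0))) /\
  (forall (X : 'cV[R]_2 -> 'cV[R]_2) (gamma : R -> 'cV[R]_2),
     Ck_near 2 X p ->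
     nilpotent_mx (jacobian_mx X p) -> \rank (jacobian_mx X p) = 1%N ->
     regular_curve_of_equilibria X p gamma ->
     forall q0 : 'cV[R]_2, spans_line q0 (col_kernel (jacobian_mx X p)) ->
     (exists b : R, is_BT_coeffs X p q0 0 b) /\
     (forall a b : R, is_BT_coeffs X p q0 a b -> a = 0)).
Proof.
split.
  move=> h Z hC ZC hp0 n0 z0 X J T.
  have JE : J = Z p *m (gradient h p)^T.
    apply: jacobian_mx_scale => //; [exact: nbhs_singleton hC.1|].
    exact: nbhs_singleton ZC.1.
  have Xp : X p = 0 by rewrite /X hp0 scale0r.
  have J1 : \rank J = 1%N by rewrite JE mxrank_rank1.
  have TE : col_kernel J = T.
    by rewrite JE col_kernel_rank1// /T tangent_space_level//; exact: Ck_nearW hC.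
  have nJE : nilpotent_mx J <-> dotv (gradient h p) (Z p) = 0.
    by rewrite JE; exact: nilpotent_rank1.
  split; first by split.
  split; first exact: nJE.
  move=> nJ q0 qT a b.
  have nz := nJE.1 nJ; split.
    (* [BT_scale] gives the same values in every frame, so the frame hidden in the hypothesis is
       harmless; the converse only has to exhibit one. *)
    move=> [_ [q1 [p0 [p1 [F -> ->]]]]].
    rewrite -/J JE in F.
    have [a0 b0] := BT_scale hC ZC hp0 n0 nz F; split; last exact: b0.
    exact: etrans (congr1 ( *%R 2^-1) a0) (mulr0 _).
  have qJ : spans_line q0 (col_kernel J) by exact: etrans TE qT.
  move=> [-> ->]; split; first by split; first exact: Ck_nearZ.
  have [q1 [p0 [p1 F]]] := BT_frame_exists nJ J1 qJ.
  have F' := F; rewrite JE in F'.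
  have [a0 b0] := BT_scale hC ZC hp0 n0 nz F'.
  exists q1, p0, p1; split; [exact: F| |exact: esym b0].
  exact: esym (etrans (congr1 ( *%R 2^-1) a0) (mulr0 _)).
move=> X gamma XC nJ J1 [gC g0 gn Xg] q0 qJ.
have Xp : X p = 0 by rewrite -g0; exact: nbhs_singleton Xg.
(* The nonzero velocity of [gamma] lies in the kernel line, so it is [c *: q0] with [c != 0]. Hence
   [B] at the velocity is [c^2 B(q0, q0)], and the vanishing passes to [q0]. *)
have a0 p1 : (jacobian_mx X p)^T *m p1 = 0 -> dotv p1 (second_diff X p q0 q0) = 0.
  move=> Jp1; have v0 := nbhs_singleton gn.
  have dg0 := nbhs_singleton gC.1.
  have vJ : col_kernel (jacobian_mx X p) (derive1 gamma 0).
    rewrite /col_kernel/= mul_jacobian_mx derive1E'//.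
    have dXg : differentiable X (gamma 0) by rewrite g0; exact: nbhs_singleton XC.1.
    by rewrite -g0; exact: diff_along_zeros.
  have := second_diff_equilibria XC gC g0 Xg Jp1.
  move: vJ v0; rewrite qJ => -[c _ <-]; rewrite scaler_eq0 negb_or => /andP[c0 _].
  have dXv w : differentiable (fun x => 'd X x w) p by exact: nbhs_singleton (XC.2 w).1.
  have -> : second_diff X p (c *: q0) (c *: q0) = c *: (c *: second_diff X p q0 q0).
    apply: etrans (diff_dirZr _ _ _ dXv) _.
    by congr (c *: _); exact: linearZ.
  by rewrite !dotvZr => /eqP; rewrite !mulf_eq0 (negPf c0) => /eqP.
split.
  have [q1 [p0 [p1 F]]] := BT_frame_exists nJ J1 qJ.
  exists (dotv p0 (second_diff X p q0 q0) + dotv p1 (second_diff X p q0 q1)).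
  split=> //; exists q1, p0, p1; split=> //.
  by case: (F) => -[_ Jp1 _] _; rewrite a0// mulr0.
by move=> a b [_ [q1 [p0 [p1 [[[_ Jp1 _] _] -> _]]]]]; rewrite a0// mulr0.
Qed.
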